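(* Let $\lambda>0$ and $\theta\in(0,1)$. For each $N\in\mathbb{N}$ let $w^{(N)}=(w_1^{(N)},\dots,w_N^{(N)})$ be a probability vector with strictly positive entries, and assume the weights are diffuse, i.e. $\max_{1\le i\le N}w_i^{(N)}\to0$ as $N\to\infty$. Suppose the clocks are homogeneous: $p_i=1/N$ for all $1\le i\le N$. Then the quorum time $\tau_{N,\theta}$ satisfies \[ \frac{\tau_{N,\theta}}{N}\longrightarrow\frac{-\log(1-\theta)}{\lambda}\quad\text{in probability as }N\to\infty. \]
   Context: For each $N$, let $T_1,\dots,T_N$ (depending on $N$) be independent with $T_i\sim\mathrm{Exp}(\lambda p_i)$ (rate $\lambda p_i$, here $\lambda/N$). Discovered-mass process: $M_N(t)=\sum_{i=1}^N w_i^{(N)}\mathbf{1}_{\{T_i\le t\}}$. Quorum time: $\tau_{N,\theta}=\inf\{t\ge0:M_N(t)>\theta\}$. *)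

(* Defs.v *)
From HB Require Import structures.
From mathcomp Require Import all_boot all_order all_algebra.
From mathcomp Require Import all_classical all_reals all_analysis.

Set Implicit Arguments.
Unset Strict Implicit.
Unset Printing Implicit Defensive.

Import Order.TTheory GRing.Theory Num.Theory.
Import numFieldNormedType.Exports.

Local Open Scope classical_set_scope.
Local Open Scope ring_scope.

Definition mutually_independent (R : realType) (d : measure_display)
    (T : measurableType d) (P : probability T R) (I : finType)
    (X : I -> {RV P >-> R}) : Prop :=
  forall (J : {set I}) (A : I -> set R), (forall i, measurable (A i)) ->
    P (\bigcap_(i in [set` J]) (X i @^-1` A i)) =
    (\prod_(i in J) P (X i @^-1` A i))%E.

(* The probability instance of exponential_prob needs a proof that the rate is
   positive, so the two laws are compared as set functions on the Borel sets. *)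
Definition exponentially_distributed (R : realType) (d : measure_display)
    (T : measurableType d) (P : probability T R) (rate : R)
    (X : {RV P >-> R}) : Prop :=
  forall A : set R, measurable A ->
    distribution P X A = exponential_prob rate A.

Definition discovered_mass (R : realType) (Omega : Type) (N : nat)
    (w : 'I_N -> R) (T : 'I_N -> Omega -> R) (t : R) (omega : Omega) : R :=
  \sum_(i < N) w i * \1_[set x | T i x <= t] omega.

(* The infimum is taken in R: it is the genuine one whenever theta is smaller
   than the total weight, since all clocks are finite and the set is then
   nonempty (the infimum of the empty set would be 0 instead of +oo). *)
Definition quorum_time (R : realType) (Omega : Type) (N : nat)
    (w : 'I_N -> R) (T : 'I_N -> Omega -> R) (theta : R) (omega : Omega) : R :=
  inf [set t : R | 0 <= t /\ theta < discovered_mass w T t omega].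

(* Each X N lives on its own probability space.  Measurability is required
   because P N has no meaning on nonmeasurable sets. *)
Definition cvg_in_probability (R : realType) (d : nat -> measure_display)
    (Omega : forall N, measurableType (d N))
    (P : forall N, probability (Omega N) R)
    (X : forall N, Omega N -> R) (c : R) : Prop :=
  (forall N, measurable_fun [set: Omega N] (X N)) /\
  forall eps : R, 0 < eps ->
    (fun N => P N [set omega | eps < `|X N omega - c|]) @ \oo --> (0 : \bar R)%E.

(* Main.v *)
(* At time N t each clock has rung with probability F(t) = 1 - exp(-lambda t), so
   the discovered mass has mean F(t) and, by pairwise independence, variance
   F(t) (1 - F(t)) \sum_i w_i^2 <= max_i w_i, which tends to 0.  By Chebyshev's
   inequality the mass concentrates at F(t).  Since F is strictly increasing and
   c = - ln (1 - theta) / lambda solves F(c) = theta, with high probability the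
   mass is still at most theta at time N (c - eps) and exceeds theta at time
   N (c + eps); hence the quorum time lies in between. *)

Require Import Defs.
From HB Require Import structures.
From mathcomp Require Import all_boot all_order all_algebra.
From mathcomp Require Import all_classical all_reals all_analysis.
From mathcomp Require Import measurable_realfun ring lra.

Set Implicit Arguments.
Unset Strict Implicit.
Unset Printing Implicit Defensive.

Import Order.TTheory GRing.Theory Num.Theory.
Import numFieldNormedType.Exports.

Local Open Scope classical_set_scope.
Local Open Scope ring_scope.

(** * Chebyshev bound for weighted sums of indicators *)

Section concentration.
Context {R : realType} {d : measure_display} {T : measurableType d}.

Lemma integral_sum_indic (P : probability T R) (I : finType)
    (c : I -> R) (B : I -> set T) :
  (forall i, 0 <= c i) -> (forall i, measurable (B i)) ->
  (\int[P]_x (\sum_i c i * \1_(B i) x)%:E = \sum_i (c i)%:E * P (B i))%E.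
Proof.
move=> c0 mB.
under eq_integral do rewrite -sumEFin.
rewrite ge0_integral_sum//=; first last.
- by move=> i x _; rewrite lee_fin mulr_ge0.
- by move=> i; apply/measurable_EFinP; exact: measurable_funM.
apply: eq_bigr => i _.
under eq_integral do rewrite EFinM.
rewrite ge0_integralZl_EFin//=.
- by rewrite integral_indic// setIT.
- by apply/measurable_EFinP.
Qed.

Lemma measurable_sum_indic (I : finType) (c : I -> R) (B : I -> set T) :
  (forall i, measurable (B i)) ->
  measurable_fun [set: T] (fun x => \sum_i c i * \1_(B i) x).
Proof.
by move=> mB; apply: measurable_sum => i; exact: measurable_funM.
Qed.

(** Pairwise independence makes the off-diagonal covariances vanish, so the variance is
    [(q - q ^+ 2) * \sum_i w i ^+ 2]. Since [w i ^+ 2 <= v * w i] and the weights sum to 1, it is at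
    most [v]. *)
Lemma weighted_indic_chebyshev (P : probability T R) (I : finType)
    (w : I -> R) (A : I -> set T) (q v e : R) :
  (forall i, 0 <= w i) -> \sum_i w i = 1 -> (forall i, w i <= v) ->
  (forall i, measurable (A i)) -> (forall i, P (A i) = q%:E) ->
  (forall i j, i != j -> P (A i `&` A j) = (q ^+ 2)%:E) ->
  0 < e ->
  (P [set x | (e <= `|(\sum_i w i * \1_(A i) x) - q|)%R] <= (v / e ^+ 2)%:E)%E.
Proof.
move=> w0 w1 wv mA PA PAA e0.
(* An empty index type would make the weights sum to 0. One event [A i0] then suffices to place [q]
   in the unit interval. *)
have [i0 _] : exists i0 : I, true.
  apply/existsP; rewrite -[X in _ X](negbK) negb_exists; apply/negP.
  move=> /forallP I0; have := oner_neq0 R; rewrite -w1 big1 ?eqxx// => i.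
  by have := I0 i.
have q0 : 0 <= q by rewrite -lee_fin -(PA i0).
have q1 : q <= 1 by rewrite -lee_fin -(PA i0) probability_le1.
set X := fun x => \sum_i w i * \1_(A i) x.
have mX : measurable_fun [set: T] X by exact: measurable_sum_indic.
have X0 x : 0 <= X x by apply: sumr_ge0 => i _; rewrite mulr_ge0.
pose XX := HB.pack_for {RV P >-> R} X (@isMeasurableFun.Build _ _ _ _ X mX).
have EX : ('E_P[XX] = q%:E)%E.
  rewrite expectation_def integral_sum_indic//.
  under eq_bigr do rewrite PA -EFinM.
  by rewrite sumEFin -mulr_suml w1 mul1r.
have mXq : measurable_fun [set: T] (fun x => ((X x - q) ^+ 2)%:E).
  by apply/measurable_EFinP; apply: measurable_funX; exact: measurable_funB.
(* Moving the cross term of (X - q)^2 to the other side keeps both integrands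
   nonnegative, so additivity of the integral needs no integrability. *)
have E2 : (\int[P]_x ((X x - q) ^+ 2)%:E =
    (\sum_i w i ^+ 2 * (q - q ^+ 2))%:E)%E.
  have split2 x : (((X x - q) ^+ 2)%:E + (2 * q)%:E * (X x)%:E =
      (\sum_(k : I * I) (w k.1 * w k.2) * \1_(A k.1 `&` A k.2) x)%:E
      + (q ^+ 2)%:E)%E.
    rewrite -EFinM -!EFinD; congr EFin.
    have -> : \sum_(k : I * I) (w k.1 * w k.2) * \1_(A k.1 `&` A k.2) x
        = X x ^+ 2.
      rewrite expr2 /X mulr_suml.
      rewrite -(pair_bigA _ (fun i j => w i * w j * \1_(A i `&` A j) x))/=.
      apply: eq_bigr => i _; rewrite mulr_sumr; apply: eq_bigr => j _.
      by rewrite indicI /= mulrACA.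
    by ring.
  have : (\int[P]_x (((X x - q) ^+ 2)%:E + (2 * q)%:E * (X x)%:E) =
     \int[P]_x ((\sum_(k : I * I) (w k.1 * w k.2) * \1_(A k.1 `&` A k.2) x)%:E
      + (q ^+ 2)%:E))%E.
    by apply: eq_integral => x _; exact: split2.
  rewrite ge0_integralD//=; last 3 first.
  - by move=> x _; rewrite lee_fin sqr_ge0.
  - by move=> x _; rewrite -EFinM lee_fin !mulr_ge0.
  - by apply: measurable_funeM; apply/measurable_EFinP.
  rewrite ge0_integralD//=; last 3 first.
  - move=> x _; rewrite lee_fin sumr_ge0// => k _.
    by rewrite !mulr_ge0.
  - apply/measurable_EFinP; apply: measurable_sum_indic => k.
    exact: measurableI.
  - by move=> x _; rewrite lee_fin sqr_ge0.
  rewrite ge0_integralZl_EFin//=; last 3 first.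
  - by move=> x _; rewrite lee_fin.
  - exact/measurable_EFinP.
  - by rewrite mulr_ge0.
  have -> : (\int[P]_x (X x)%:E = q%:E)%E by rewrite -EX expectation_def.
  rewrite integral_cst//= probability_setT mule1.
  rewrite integral_sum_indic; last 2 first.
  - by move=> k; rewrite mulr_ge0.
  - by move=> k; exact: measurableI.
  rewrite -(pair_bigA _ (fun i j => (w i * w j)%:E * P (A i `&` A j)))%E/=.
  have -> : (\sum_i \sum_j (w i * w j)%:E * P (A i `&` A j) =
     (\sum_i w i ^+ 2 * (q - q ^+ 2) + q ^+ 2)%:E)%E.
    transitivity (\sum_i (w i ^+ 2 * (q - q ^+ 2) + w i * q ^+ 2)%:E)%E.
      apply: eq_bigr => i _.
      (* Every pair is counted with probability [q ^+ 2]; the diagonal, where it is [q], receives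
         the correction [q - q ^+ 2]. *)
      transitivity (\sum_j (w i * w j * q ^+ 2 +
           (if j == i then w i ^+ 2 * (q - q ^+ 2) else 0))%:E)%E.
        apply: eq_bigr => j _; case: eqVneq => [->|ji].
          by rewrite setIid PA -EFinM; congr EFin; ring.
        by rewrite PAA 1?eq_sym// -EFinM addr0.
      rewrite sumEFin big_split/= -big_mkcond big_pred1_eq.
      by rewrite -mulr_suml -mulr_sumr w1 mulr1 addrC.
    by rewrite sumEFin big_split/= -mulr_suml -[in X in _ + X]mulr_suml w1 mul1r.
  (* The cross term can be cancelled only for a finite integral; infinite values contradict the
     finite right-hand side. *)
  move=> /eqP; rewrite -EFinM -EFinD; case: integral => [r| |]//=.
  rewrite -EFinD eqe => /eqP h; congr EFin.
  by move: h; set z := \sum_i _; move=> h; lra.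
have VX : ('V_P[XX] <= v%:E)%E.
  rewrite /variance unlock EX/=.
  rewrite unlock; under eq_integral do rewrite -expr2.
  rewrite [leLHS](_ : _ = \int[P]_x ((X x - q) ^+ 2)%:E)%E//.
  rewrite E2 lee_fin.
  have qq : 0 <= q - q ^+ 2 <= 1 by nra.
  apply: (@le_trans _ _ (\sum_i v * w i)).
    apply: ler_sum => i _; have := wv i; have := w0 i; nra.
  by rewrite -mulr_sumr w1 mulr1.
have := @chebyshev _ _ _ P XX e e0; rewrite EX/=.
move=> /le_trans; apply.
rewrite mulrC EFinM; apply: lee_wpmul2l => //.
by rewrite lee_fin invr_ge0 sqr_ge0.
Qed.

End concentration.

(** The density vanishes on the negative half-line, so only the interval from 0 to [s]
    contributes. *)
Lemma exponential_prob_ray (R : realType) (r s : R) : 0 < r -> 0 < s ->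
  exponential_prob r `]-oo, s] = (1 - expR (- r * s))%:E.
Proof.
move=> r0 s0.
have -> : `]-oo, s]%classic = `]-oo, 0[%classic `|` `[0, s]%classic :> set R.
  rewrite -itv_bndbnd_setU//= bnd_simp; exact: ltW.
rewrite /exponential_prob ge0_integral_setU//=.
- rewrite integral0_eq ?add0e.
    by have := exponential_prob_itv0c r s0; rewrite /exponential_prob => ->.
  by move=> x; rewrite /= in_itv/= => x0; rewrite lt0_exponential_pdf.
- apply/measurable_EFinP; apply: measurable_funTS.
  exact: measurable_exponential_pdf.
- by move=> x _; rewrite lee_fin exponential_pdf_ge0// ltW.
- apply/disj_setPS => x /= []; rewrite !in_itv/= => x0 /andP[x1 _].
  by move: x0; rewrite ltNge x1.
Qed.

(** * The quorum time as a generalized inverse of the mass, and its measurability *)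

Section quorum.
Context {R : realType} {Omega : Type} {N : nat}.
Variables (w : 'I_N -> R) (T : 'I_N -> Omega -> R) (theta : R).
Hypotheses (w_ge0 : forall i, 0 <= w i) (theta_lt : theta < \sum_i w i).

Lemma discovered_mass_le (s t : R) (x : Omega) : s <= t ->
  discovered_mass w T s x <= discovered_mass w T t x.
Proof.
move=> st; apply: ler_sum => i _; apply: ler_wpM2l => //.
rewrite !indicE ler_nat; case: (boolP (x \in _)) => //; rewrite inE/= => Ts.
by rewrite mem_set//=; exact: le_trans st.
Qed.

(** The strict inequality provides an actual time before [t] at which the quorum holds, so whether
    the infimum is attained does not matter. *)
Lemma quorum_time_lt x t : quorum_time w T theta x < t <->
  exists s, [/\ 0 <= s, s < t & theta < discovered_mass w T s x].
Proof.
split.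
- move=> /inf_lt[|s [s0 sM] st]; last by exists s.
  (* The set is nonempty: at the largest clock value all clocks have rung and the mass is the total
     weight, which exceeds [theta]. The default 0 makes this time nonnegative. *)
  exists (\big[Num.max/0]_i T i x); split; first exact: bigmax_ge_id.
  rewrite /discovered_mass; under eq_bigr => i _.
    rewrite indicE mem_set/= ?mulr1; last exact: le_bigmax.
    over.
  by [].
- move=> [s [s0 st sM]]; apply: le_lt_trans st.
  by apply: ge_inf => //; exists 0 => y [].
Qed.

End quorum.

Lemma measurable_sublevel (R : realType) (d : measure_display)
    (Omega : measurableType d) (X : {mfun Omega >-> R}) (t : R) :
  measurable [set x | X x <= t].
Proof.
rewrite (_ : [set x | _] = X @^-1` `]-oo, t]); first exact: measurable_funPTI.
by apply/seteqP; split => x /=; rewrite in_itv.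
Qed.

Lemma measurable_quorum_time (R : realType) (d : measure_display)
    (Omega : measurableType d) (N : nat) (w : 'I_N -> R)
    (T : 'I_N -> {mfun Omega >-> R}) (theta : R) :
  (forall i, 0 <= w i) -> theta < \sum_i w i ->
  measurable_fun [set: Omega] (quorum_time w T theta).
Proof.
move=> w0 tw mD; apply: (measurability _ (RGenInftyO.measurableE R)) => //.
move=> _ [_ [t ->] <-]; rewrite setTI.
(* Monotonicity of the discovered mass allows restricting to rational times. *)
have -> : quorum_time w T theta @^-1` `]-oo, t[ =
    \bigcup_(r in [set r : rat | 0 <= (ratr r : R) /\ (ratr r : R) < t])
      [set x | theta < discovered_mass w T (ratr r) x].
  apply/seteqP; split => x /=; rewrite in_itv/=.
    move=> /(quorum_time_lt T tw)[s [s0 st sM]].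
    have [r /[!in_itv]/= /andP[sr rt]] := rat_in_itvoo st.
    exists r => /=; first by split => //; exact: le_trans (ltW sr).
    by apply: lt_le_trans sM _; apply: discovered_mass_le => //; exact: ltW.
  move=> [r /= [r0 rt] rM]; apply/(quorum_time_lt T tw).
  by exists (ratr r).
rewrite bigcup_mkcond; apply: bigcupT_measurable_rat => r; case: ifP => // _.
rewrite -[X in measurable X]setTI.
have mM : measurable_fun [set: Omega] (discovered_mass w T (ratr r)).
  apply: measurable_sum => i; apply: measurable_funM => //.
  apply: measurable_indic.
  exact: measurable_sublevel.
rewrite (_ : [set x | _] = discovered_mass w T (ratr r) @^-1` `]theta, +oo[).
  by apply: mM.
by apply/seteqP; split => x /=; rewrite in_itv/= andbT.
Qed.

Lemma measurable_dist_gt (R : realType) (d : measure_display)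
    (Omega : measurableType d) (f : Omega -> R) (c e : R) :
  measurable_fun [set: Omega] f -> measurable [set x | e < `|f x - c|].
Proof.
move=> mf.
rewrite (_ : [set x | _] = (fun x => `|f x - c|) @^-1` `]e, +oo[).
  rewrite -[X in measurable X]setTI; apply: measurableT_comp => //.
  exact: measurable_funB.
by apply/seteqP; split => x /=; rewrite in_itv/= andbT.
Qed.

(** * Homogeneous clocks at a fixed [N]: concentration of the mass and tail of the quorum time *)

Section homogeneous_clocks.
Context {R : realType} {d : measure_display} {Omega : measurableType d}.
Context {P : probability Omega R} {N : nat}.
Variables (lambda : R) (w : 'I_N -> R) (T : 'I_N -> {RV P >-> R}) (v : R).
Hypotheses (N_gt0 : (0 < N)%N) (lambda_gt0 : 0 < lambda).
Hypotheses (w_ge0 : forall i, 0 <= w i) (w_sum1 : \sum_i w i = 1).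
Hypotheses (w_le : forall i, w i <= v) (T_indep : mutually_independent T).
Hypothesis T_exp :
  forall i, exponentially_distributed (lambda * (1 / N%:R)) (T i).

Let N_gt0R : 0 < N%:R :> R.
Proof. by rewrite ltr0n. Qed.

(** The factor [N%:R] in the time cancels the one in the rate, so the probability depends on neither
    [N] nor [i]. *)
Lemma clock_le_prob (t : R) (i : 'I_N) : 0 < t ->
  P [set x | T i x <= t * N%:R] = (1 - expR (- lambda * t))%:E.
Proof.
move=> t0.
have -> : [set x | T i x <= t * N%:R] = T i @^-1` `]-oo, t * N%:R].
  by apply/seteqP; split => x /=; rewrite in_itv.
have /= := T_exp i (measurable_itv `]-oo, t * N%:R]).
rewrite exponential_prob_ray ?mulr_gt0 ?divr_gt0 ?invr_gt0//.
rewrite /distribution/= /pushforward => ->.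
congr (1 - expR _)%:E.
by field; rewrite gt_eqF.
Qed.

Lemma clock_le_pair_prob (t : R) (i j : 'I_N) : 0 < t -> i != j ->
  P ([set x | T i x <= t * N%:R] `&` [set x | T j x <= t * N%:R]) =
  ((1 - expR (- lambda * t)) ^+ 2)%:E.
Proof.
move=> t0 ij.
(* Mutual independence is applied to the index set of [i] and [j], with the same ray for every
   index. *)
pose A (_ : 'I_N) : set R := [set y | y <= t * N%:R].
have mA k : measurable (A k).
  rewrite (_ : A k = `]-oo, t * N%:R]%classic); first exact: measurable_itv.
  by apply/seteqP; split => y /=; rewrite in_itv.
transitivity (P (\bigcap_(k in [set` [set i; j]%SET]) (T k @^-1` A k))).
  congr (P _); apply/seteqP; split => x /=.
  - by move=> [xi xj] k /=; rewrite !inE => /orP[] /eqP ->.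
  - by move=> h; split; apply: (h _ _); rewrite /= !inE eqxx ?orbT.
rewrite T_indep// big_setU1 ?inE//= big_set1 expr2 EFinM.
by congr (_ * _)%E; exact: clock_le_prob.
Qed.

Lemma discovered_mass_chebyshev (t e : R) : 0 < t -> 0 < e ->
  (P [set x | (e <= `|discovered_mass w T (t * N%:R) x -
                      (1 - expR (- lambda * t))|)%R] <= (v / e ^+ 2)%:E)%E.
Proof.
move=> t0 e0; apply: weighted_indic_chebyshev => //.
- by move=> i; exact: measurable_sublevel.
- by move=> i; exact: clock_le_prob.
- by move=> i j; exact: clock_le_pair_prob.
Qed.

(** Each summand is the Chebyshev bound at one of the times [c - eps] and [c + eps], the allowed
    deviation being the gap between [theta] and the mean mass there. The condition [eps < c] keeps
    the earlier time positive. *)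
Lemma quorum_time_tail (theta c eps : R) :
  theta < 1 -> expR (- lambda * c) = 1 - theta -> 0 < eps -> eps < c ->
  (P [set x | (eps < `|quorum_time w T theta x / N%:R - c|)%R] <=
   (v * ((theta - (1 - expR (- lambda * (c - eps)))) ^- 2 +
         ((1 - expR (- lambda * (c + eps))) - theta) ^- 2))%:E)%E.
Proof.
move=> theta1 expc eps0 epsc.
have wtheta : theta < \sum_i w i by rewrite w_sum1.
set F := fun t : R => 1 - expR (- lambda * t).
set e1 := theta - F (c - eps); set e2 := F (c + eps) - theta.
have thetaE : theta = F c by rewrite /F expc; ring.
have F_lt s t : s < t -> F s < F t.
  by move=> st; rewrite ltrD2l ltrN2 ltr_expR !mulNr ltrN2 ltr_pM2l.
have e1_gt0 : 0 < e1 by rewrite subr_gt0 thetaE F_lt// gtrBl.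
have e2_gt0 : 0 < e2 by rewrite subr_gt0 thetaE F_lt// ltrDl.
pose dev (t e : R) :=
  [set x | e <= `|discovered_mass w T (t * N%:R) x - F t|].
have mdev t e : measurable (dev t e).
  rewrite (_ : dev t e = (fun x => `|discovered_mass w T (t * N%:R) x - F t|)
      @^-1` `[e, +oo[); last first.
    by apply/seteqP; split => x /=; rewrite in_itv/= andbT.
  rewrite -[X in measurable X]setTI; apply: measurableT_comp => //.
  apply: measurable_funB => //; apply: measurable_sum_indic => i.
  exact: measurable_sublevel.
have mtau : measurable_fun [set: Omega] (quorum_time w T theta).
  exact: measurable_quorum_time.
have mtail : measurable
    [set x | eps < `|quorum_time w T theta x / N%:R - c|].
  by apply: measurable_dist_gt; exact: measurable_funM.
have sub : [set x | eps < `|quorum_time w T theta x / N%:R - c|] `<=`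
    dev (c - eps) e1 `|` dev (c + eps) e2.
  (* A late quorum means that the mass has not passed [theta] at the later time, or that time would
     bound the infimum. An early quorum means, by monotonicity, that the mass already exceeds
     [theta] at the earlier time. *)
  move=> x /=; rewrite lter_normr => /orP[late|early]; [right|left].
  - rewrite /dev/= ler_normr; apply/orP; right.
    suff : discovered_mass w T ((c + eps) * N%:R) x <= theta.
      by rewrite /e2; lra.
    rewrite leNgt; apply/negP => Mt.
    have : (c + eps) * N%:R < quorum_time w T theta x.
      by rewrite -ltr_pdivlMr//; lra.
    rewrite ltNge => /negP; apply.
    apply: ge_inf; first by exists 0 => y [].
    by split => //; rewrite mulr_ge0//; lra.
  - rewrite /dev/= ler_normr; apply/orP; left.
    suff : theta < discovered_mass w T ((c - eps) * N%:R) x.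
      by rewrite /e1; lra.
    have : quorum_time w T theta x < (c - eps) * N%:R.
      by rewrite -ltr_pdivrMr//; lra.
    move=> /(quorum_time_lt T wtheta)[s [s0 st sM]].
    by apply: lt_le_trans sM _; apply: discovered_mass_le => //; exact: ltW.
apply: (@le_trans _ _ (P (dev (c - eps) e1 `|` dev (c + eps) e2))).
  by apply: le_measure => //; rewrite inE//; exact: measurableU.
apply: (le_trans (measureU2 _ (mdev _ _) (mdev _ _))).
rewrite mulrDr EFinD; apply: leeD.
- by apply: discovered_mass_chebyshev => //; lra.
- by apply: discovered_mass_chebyshev => //; lra.
Qed.

End homogeneous_clocks.

(** * Passage to the limit for diffuse weights *)

Theorem theorem4p1 (R : realType) (lambda theta : R)
    (w p : forall N : nat, 'I_N -> R)
    (d : nat -> measure_display) (Omega : forall N : nat, measurableType (d N))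
    (P : forall N : nat, probability (Omega N) R)
    (T : forall N : nat, 'I_N -> {RV (P N) >-> R})
    (lambda_gt0 : 0 < lambda) (theta_gt0 : 0 < theta) (theta_lt1 : theta < 1)
    (w_gt0 : forall (N : nat) (i : 'I_N), 0 < w N i)
    (w_sum1 : forall N : nat, (0 < N)%N -> \sum_(i < N) w N i = 1)
    (w_diffuse :
      (fun N : nat => \big[Num.max/0]_(i < N) w N i) @ \oo --> (0 : R))
    (p_homogeneous : forall (N : nat) (i : 'I_N), p N i = 1 / N%:R)
    (T_independent : forall N : nat, mutually_independent (T N))
    (T_exponential : forall (N : nat) (i : 'I_N),
      exponentially_distributed (lambda * p N i) (T N i)) :
  cvg_in_probability P
    (fun N omega => quorum_time (w N) (T N) theta omega / N%:R)
    (- ln (1 - theta) / lambda).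
Proof.
set c := - ln (1 - theta) / lambda.
have c_gt0 : 0 < c.
  by rewrite divr_gt0// oppr_gt0 ln_lt0//; lra.
have expc : expR (- lambda * c) = 1 - theta.
  have -> : - lambda * c = ln (1 - theta) by rewrite /c; field; rewrite gt_eqF.
  by rewrite lnK// posrE; lra.
have T_exp N (i : 'I_N) :
    exponentially_distributed (lambda * (1 / N%:R)) (T N i).
  by rewrite -(p_homogeneous N i); exact: T_exponential.
have mtau N : measurable_fun [set: Omega N]
    (fun x => quorum_time (w N) (T N) theta x / N%:R).
  (* For [N = 0] the weights do not sum to 1, but division by 0 yields 0 and the quotient is
     constant. *)
  case: N => [|N].
    rewrite (_ : (fun _ => _) = cst 0)//; apply/funext => x.
    by rewrite invr0 mulr0.
  apply: measurable_funM => //.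
  apply: measurable_quorum_time; first by move=> i; exact: ltW.
  by rewrite w_sum1.
split=> // eps0 eps0_gt0.
(* Shrinking the tolerance only enlarges the deviation event, and the cap [c / 2] ensures
   [eps < c]. *)
pose eps := Num.min eps0 (c / 2).
have eps_gt0 : 0 < eps by rewrite lt_min eps0_gt0 divr_gt0.
have eps_lt : eps < c by rewrite gt_min; apply/orP; right; lra.
set K := ((theta - (1 - expR (- lambda * (c - eps)))) ^- 2 +
       ((1 - expR (- lambda * (c + eps))) - theta) ^- 2).
(* The factor [K] is independent of [N], so diffuseness alone drives the upper bound to 0. *)
apply: (@squeeze_cvge _ _ _ _ (cst 0%E) _
  (fun N => ((\big[Num.max/0]_(i < N) w N i) * K)%:E)).
- near=> N; rewrite measure_ge0/=.
  have N0 : (0 < N)%N by near: N; exact: nbhs_infty_gt.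
  have w_ge0 i : 0 <= w N i by exact: ltW.
  have w_le i : w N i <= \big[Num.max/0]_(j < N) w N j by exact: le_bigmax.
  apply: le_trans (quorum_time_tail N0 lambda_gt0 w_ge0 (w_sum1 N N0) w_le
    (T_independent N) (T_exp N) theta_lt1 expc eps_gt0 eps_lt).
  apply: le_measure; rewrite ?inE.
  1,2: exact: measurable_dist_gt.
  by move=> x /=; apply: le_lt_trans; rewrite ge_min lexx.
- exact: cvg_cst.
- apply: cvg_EFin; first by near=> N.
  rewrite -[X in _ --> X](mul0r K).
  by apply: cvgM => //; exact: cvg_cst.
Unshelve. all: by end_near.
Qed.
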